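(* Let $A$ be a finitely generated group having the unique root property, and let $K$ be a normal subgroup of $A$ such that the quotient $G=A/K$ is finite and centerless (i.e. has trivial center). Let $L$ be a subgroup of $A$ containing $K$. Then $\mathrm{Out}(A)$ can be virtually embedded into $\mathrm{Out}(L)$, i.e. there exist a finite-index subgroup $H\le\mathrm{Out}(A)$ and an injective group homomorphism $H\hookrightarrow\mathrm{Out}(L)$.
   Context: A group $A$ has the unique root property if for every positive integer $n$ and all $x,y\in A$, $x^n=y^n$ implies $x=y$. $\mathrm{Out}(G)=\mathrm{Aut}(G)/\mathrm{Inn}(G)$ is the outer automorphism group of a group $G$, where $\mathrm{Inn}(G)$ is the group of conjugations by elements of $G$. *)

(* Defs.v *)
From HB Require Import structures.
From mathcomp Require Import all_boot.
From mathcomp Require Import boolp classical_sets functions cardinality.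

Set Implicit Arguments.
Unset Strict Implicit.
Unset Printing Implicit Defensive.

Local Open Scope classical_set_scope.
Local Open Scope quotient_scope.
Local Open Scope group_scope.

(* Groups are MathComp's groupType, with no finiteness assumption; subgroups are
   its groupClosed predicates. These are boolean, which loses no generality
   since every predicate is boolean in the classical setting of boolp; for the
   same reason the decidable equality and choice carried by a groupType are no
   restriction. *)

Section GroupProperties.
Variable G : groupType.

Definition unique_roots :=
  forall (n : nat) (x y : G), (0 < n)%N -> x ^+ n = y ^+ n -> x = y.

(* Some finite s is contained in no proper subgroup. *)
Definition finitely_generated :=
  exists s : seq G, forall S : groupClosed G,
    {subset s <= S} -> forall x : G, x \in S.

Definition centerless :=
  forall z : G, (forall x : G, commute z x) -> z = 1.

Definition lcoset (H : {pred G}) (x : G) : set G := [set x * h | h in [set` H]].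

Definition finite_index (H : {pred G}) := finite_set (range (lcoset H)).

End GroupProperties.

Section Subgroup.
Variables (G : groupType) (H : groupClosed G).

Record subgroup := Subgroup {
  subgroup_val :> G;
  subgroup_valP : subgroup_val \in H
}.

HB.instance Definition _ := [isSub for subgroup_val].
HB.instance Definition _ := [Choice of subgroup by <:].

Fact subgroup_closed : group_closed H.
Proof. by split=> [|x y Hx Hy]; rewrite ?gpred1 ?gpredF. Qed.

HB.instance Definition _ :=
  SubChoice_isSubGroup.Build G (fun x => x \in H) subgroup subgroup_closed.

End Subgroup.

HB.mixin Record isConjClosed (G : groupType) (S : {pred G}) := {
  gpredJr : forall x y : G, x \in S -> x ^ y \in S
}.

#[short(type="normalClosed")]
HB.structure Definition NormalClosed (G : groupType) :=
  {S of isConjClosed G S & GroupClosed G S}.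

Section Quotient.
Variables (G : groupType) (N : normalClosed G).
Implicit Types x y z : G.

Definition eqcoset : rel G := fun x y => x^-1 * y \in N.

Lemma eqcoset_equiv : equiv_class_of eqcoset.
Proof.
split=> [x | x y | y x z].
- by rewrite /eqcoset mulVg gpred1.
- by rewrite /eqcoset -gpredV invgM invgK.
- by rewrite /eqcoset => Nxy Nyz; rewrite -(mulVKg y z) mulgA gpredM.
Qed.

Canonical eqcoset_equivRel := EquivRelPack eqcoset_equiv.

Definition quotient_group := {eq_quot eqcoset}.

HB.instance Definition _ := Choice.on quotient_group.
HB.instance Definition _ := EqQuotient.on quotient_group.

Definition coset x : quotient_group := \pi_quotient_group x.

Lemma eq_cosetP x y : reflect (coset x = coset y) (x^-1 * y \in N).
Proof. exact: eqmodP. Qed.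

Lemma coset_repr (q : quotient_group) : coset (repr q) = q.
Proof. exact: reprK. Qed.

Definition coset_mul (p q : quotient_group) := coset (repr p * repr q).
Definition coset_inv (p : quotient_group) := coset (repr p)^-1.

Lemma coset_mulE x y : coset_mul (coset x) (coset y) = coset (x * y).
Proof.
apply/esym/eq_cosetP; rewrite invgM.
have /eq_cosetP Nx : coset x = coset (repr (coset x)) by rewrite coset_repr.
have /eq_cosetP Ny : coset y = coset (repr (coset y)) by rewrite coset_repr.
move: (repr _) (repr _) Nx Ny => y' x' Nx Ny.
have -> : y^-1 * x^-1 * (x' * y') = (x^-1 * x') ^ y * (y^-1 * y').
  by rewrite conjgE !mulgA mulgK.
by rewrite gpredM // gpredJr.
Qed.

Lemma coset_invE x : coset_inv (coset x) = coset x^-1.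
Proof.
apply/esym/eq_cosetP; rewrite invgK.
have /eq_cosetP Nx : coset x = coset (repr (coset x)) by rewrite coset_repr.
move: (repr _) Nx => x' Nx.
rewrite -gpredV invgM invgK.
have -> : x' * x^-1 = (x^-1 * x') ^ x^-1 by rewrite conjgE invgK mulgA mulVKg.
by rewrite gpredJr.
Qed.

Fact coset_mulA : associative coset_mul.
Proof.
move=> p q r; rewrite -(coset_repr p) -(coset_repr q) -(coset_repr r).
by rewrite !coset_mulE mulgA.
Qed.

Fact coset_mul1 : left_id (coset 1) coset_mul.
Proof. by move=> p; rewrite -(coset_repr p) coset_mulE mul1g. Qed.

Fact coset_mulr1 : right_id (coset 1) coset_mul.
Proof. by move=> p; rewrite -(coset_repr p) coset_mulE mulg1. Qed.

Fact coset_mulV : left_inverse (coset 1) coset_inv coset_mul.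
Proof. by move=> p; rewrite -(coset_repr p) coset_invE coset_mulE mulVg. Qed.

Fact coset_mulrV : right_inverse (coset 1) coset_inv coset_mul.
Proof. by move=> p; rewrite -(coset_repr p) coset_invE coset_mulE mulgV. Qed.

HB.instance Definition _ := isGroup.Build quotient_group
  coset_mulA coset_mul1 coset_mulr1 coset_mulV coset_mulrV.

End Quotient.

Section Automorphisms.
Variable G : groupType.

(* An automorphism is stored with its inverse function, which it determines;
   autP is extensional equality. The product is composition. *)
Record aut := Aut {
  aut_fun :> G -> G;
  aut_finv : G -> G;
  autM : {morph aut_fun : x y / x * y};
  autK : cancel aut_fun aut_finv;
  autVK : cancel aut_finv aut_fun
}.

Lemma autP (f g : aut) : f =1 g -> f = g.
Proof.
case: f g => [f f' fM fK f'K] [g g' gM gK g'K] /= /funext eq_fg; subst g.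
have eq_fg' : f' = g' by apply/funext=> x; rewrite -{1}(g'K x) fK.
by subst g'; congr Aut; exact: Prop_irrelevance.
Qed.

HB.instance Definition _ := gen_eqMixin aut.
HB.instance Definition _ := gen_choiceMixin aut.

Definition aut_one : aut :=
  @Aut id id (fun _ _ => erefl) (fun=> erefl) (fun=> erefl).

Fact aut_mulM (f g : aut) : {morph f \o g : x y / x * y}.
Proof. by move=> x y /=; rewrite !autM. Qed.

Definition aut_mul (f g : aut) : aut :=
  Aut (aut_mulM f g) (can_comp (@autK f) (@autK g))
      (can_comp (@autVK g) (@autVK f)).

Fact aut_invM (f : aut) : {morph aut_finv f : x y / x * y}.
Proof.
by move=> x y; rewrite -[RHS](@autK f) autM !autVK.
Qed.

Definition aut_inv (f : aut) : aut := Aut (aut_invM f) (@autVK f) (@autK f).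

Fact aut_mulA : associative aut_mul.
Proof. by move=> f g h; exact: autP. Qed.

Fact aut_mul1 : left_id aut_one aut_mul.
Proof. by move=> f; exact: autP. Qed.

Fact aut_mulr1 : right_id aut_one aut_mul.
Proof. by move=> f; exact: autP. Qed.

Fact aut_mulV : left_inverse aut_one aut_inv aut_mul.
Proof. by move=> f; apply: autP => x; exact: autK. Qed.

Fact aut_mulrV : right_inverse aut_one aut_inv aut_mul.
Proof. by move=> f; apply: autP => x; exact: autVK. Qed.

HB.instance Definition _ := isGroup.Build aut
  aut_mulA aut_mul1 aut_mulr1 aut_mulV aut_mulrV.

Lemma aut1E x : (1 : aut) x = x. Proof. by []. Qed.
Lemma autME (f g : aut) x : (f * g) x = f (g x). Proof. by []. Qed.
Lemma autVE (f : aut) x : f^-1 x = aut_finv f x. Proof. by []. Qed.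

Lemma aut_fun1 (f : aut) : f 1 = 1.
Proof. by apply: (mulgI (f 1)); rewrite -autM !mulg1. Qed.

Lemma autV (f : aut) x : f x^-1 = (f x)^-1.
Proof. by apply: (mulgI (f x)); rewrite -autM !mulgV aut_fun1. Qed.

(* x ^ a is a^-1 * x * a; as a ranges over G this covers every conjugation. *)
Definition inn : {pred aut} := 
  fun f => `[< exists a : G, forall x, f x = x ^ a >].

Lemma innP (f : aut) : reflect (exists a : G, forall x, f x = x ^ a) (f \in inn).
Proof. exact: asboolP. Qed.

Fact inn1 : 1 \in inn.
Proof. by apply/innP; exists 1 => x; rewrite conjg1. Qed.

Fact innM : mulg_closed inn.
Proof.
move=> f g /innP[a fa] /innP[b gb]; apply/innP; exists (b * a) => x.
by rewrite autME fa gb conjgM.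
Qed.

Fact innV : invg_closed inn.
Proof.
move=> f /innP[a fa]; apply/innP; exists a^-1 => x.
by rewrite -[X in f^-1 X](conjgKV a) -fa -autME mulVg.
Qed.

Fact innJ (f g : aut) : f \in inn -> f ^ g \in inn.
Proof.
move=> /innP[a fa]; apply/innP; exists (g^-1 a) => x.
by rewrite !conjgE !autME fa conjgE !autM !autV !autVE autK.
Qed.

HB.instance Definition _ := isMulClosed.Build aut inn innM.
HB.instance Definition _ := isMul1Closed.Build aut inn inn1.
HB.instance Definition _ := isInvClosed.Build aut inn innV.
HB.instance Definition _ := isConjClosed.Build aut inn innJ.

Definition out := quotient_group inn.
HB.instance Definition _ := Group.on out.

End Automorphisms.

Arguments inn : clear implicits.

(* Main.v *)
Require Import Defs.
From mathcomp Require Import all_boot.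
From mathcomp Require Import classical_sets cardinality.
From HB Require Import structures.
From mathcomp Require Import boolp.

(** Write [G] for the finite centerless quotient [A / K], and let [Gamma] be the
    group of automorphisms of [A] that induce the identity on [G].

    [Gamma] has finite index in [aut A]. An automorphism [f] determines a
    homomorphism [A -> G], namely [f] followed by the projection; as [A] is
    finitely generated and [G] is finite there are only finitely many of these,
    and automorphisms with the same homomorphism differ by an element of
    [Gamma] ([finite_index_inducing1]).

    An element of [Gamma] moves each point inside its coset of [K], so it
    preserves every subgroup [L] that contains [K] and restricts to an
    automorphism of [L] ([restr]). The key point ([restr_inn]) is that the
    restriction is inner exactly when the automorphism itself is inner:
    - conjugation by [a] lies in [Gamma] only when the coset of [a] is central
      in [G], that is, when [a] is in [K], hence in [L], because [G] is
      centerless ([inner_inducing1]);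
    - an automorphism that agrees on [L] with a conjugation agrees with it on
      all of [A]: every [x] in [A] has a positive power in [K], hence in [L],
      and roots are unique in [A] ([eq_aut_on_roots]).
    Restriction therefore induces an injective homomorphism from the image of
    [Gamma] in [out A] to [out L] ([embed_image_quotient]). *)

Set Implicit Arguments.
Unset Strict Implicit.
Unset Printing Implicit Defensive.

Local Open Scope classical_set_scope.
Local Open Scope group_scope.

(** * Finiteness *)

Lemma finite_range_factor (T U : Type) (V : choiceType) (f : T -> U)
    (g : T -> V) :
  (forall x y, g x = g y -> f x = f y) ->
  finite_set (range g) -> finite_set (range f).
Proof.
move=> fg fin_g.
have [[x0]|noT] := pselect (inhabited T); last first.
  rewrite (_ : range f = set0) //.
  by apply/seteqP; split=> [y [x]|y []]; case: noT.
pose h v := if pselect (exists x, g x = v) is left e then f (sval (cid e))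
            else f x0.
apply: sub_finite_set (finite_image h fin_g) => _ [x _ <-].
exists (g x) => //; rewrite /h; case: pselect => [e|[]]; last by exists x.
by apply: fg; case: cid.
Qed.

Lemma finite_range_map (T I Q : Type) (F : T -> I -> Q) (s : seq I) :
  finite_set [set: Q] -> finite_set (range (fun t => map (F t) s)).
Proof.
move=> finQ; elim: s => [|i s IHs] /=.
  by apply: (sub_finite_set _ (finite_set1 [::])) => _ [_ _ <-].
apply: (finite_image11 cons _ IHs).
exact: sub_finite_set finQ.
Qed.

(** Pigeonhole on the powers of [x]. *)
Lemma finite_group_torsion (G : groupType) (x : G) :
  finite_set [set: G] -> exists2 n, (0 < n)%N & x ^+ n = 1.
Proof.
move=> finG; apply: contrapT => notors; apply: infinite_nat.
rewrite -(preimage_setT (fun n => x ^+ n)).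
apply: finite_preimage finG => i j _ _ /=.
wlog le_ij : i j / (i <= j)%N => [ij eq_ij|eq_ij].
  by case/orP: (leq_total i j) => /ij; [exact | move=> /(_ (esym eq_ij))].
apply/eqP; rewrite eqn_leq le_ij /= leqNgt; apply/negP => lt_ij; apply: notors.
exists (j - i)%N; first by rewrite subn_gt0.
by apply: (mulgI (x ^+ i)); rewrite -expgnDr subnKC // mulg1.
Qed.

(** * Passing a subgroup to quotients *)

Lemma cosetM (G : groupType) (N : normalClosed G) (x y : G) :
  coset N (x * y) = coset N x * coset N y.
Proof. exact/esym/coset_mulE. Qed.

Lemma cosetV (G : groupType) (N : normalClosed G) (x : G) :
  coset N x^-1 = (coset N x)^-1.
Proof. exact/esym/coset_invE. Qed.

Lemma coset_eq1 (G : groupType) (N : normalClosed G) (x : G) :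
  coset N x = 1 <-> x \in N.
Proof.
split=> [/esym/eq_cosetP|Nx]; first by rewrite invg1 mul1g.
by apply/esym/eq_cosetP; rewrite invg1 mul1g.
Qed.

Section ImageQuotient.
Variables (G : groupType) (N : normalClosed G) (S : groupClosed G).

Definition image_quotient : {pred quotient_group N} :=
  fun q => `[< exists2 g, g \in S & coset N g = q >].

Lemma image_quotientP q :
  reflect (exists2 g, g \in S & coset N g = q) (q \in image_quotient).
Proof. exact: asboolP. Qed.

Fact image_quotientM : mulg_closed image_quotient.
Proof.
move=> _ _ /image_quotientP[g Sg <-] /image_quotientP[h Sh <-].
by apply/image_quotientP; exists (g * h); rewrite ?cosetM ?gpredM.
Qed.

Fact image_quotient1 : 1 \in image_quotient.
Proof. by apply/image_quotientP; exists 1; rewrite ?gpred1. Qed.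

Fact image_quotientV : invg_closed image_quotient.
Proof.
move=> _ /image_quotientP[g Sg <-].
by apply/image_quotientP; exists g^-1; rewrite ?cosetV ?gpredV.
Qed.

HB.instance Definition _ :=
  isMulClosed.Build (quotient_group N) image_quotient image_quotientM.
HB.instance Definition _ :=
  isMul1Closed.Build (quotient_group N) image_quotient image_quotient1.
HB.instance Definition _ :=
  isInvClosed.Build (quotient_group N) image_quotient image_quotientV.

(** The coset of [coset N x] modulo the image of [S] depends only on the coset
    of [x] modulo [S], so an invariant [c] that separates the latter bounds the
    number of the former. *)
Lemma finite_index_image (V : choiceType) (c : G -> V) :
  (forall x y, c x = c y -> x^-1 * y \in S) -> finite_set (range c) ->
  finite_index image_quotient.
Proof.
move=> cS fin_c.
apply: sub_finite_set (finite_range_factor (f := fun x =>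
  lcoset image_quotient (coset N x)) (g := c) _ fin_c).
  by move=> _ [q _ <-]; exists (repr q) => //; rewrite coset_repr.
have sub x y : x^-1 * y \in S ->
    lcoset image_quotient (coset N x) `<=` lcoset image_quotient (coset N y).
  move=> Sxy _ [_ /image_quotientP[g Sg <-] <-].
  exists (coset N ((x^-1 * y)^-1 * g)).
    by apply/image_quotientP; exists ((x^-1 * y)^-1 * g); rewrite // gpredM ?gpredV.
  by rewrite -!cosetM invgM invgK !mulgA mulgV mul1g.
move=> x y /cS Sxy; apply/seteqP; split; apply: sub => //.
by rewrite -gpredV invgM invgK.
Qed.

(** A homomorphism [r] on [S] under which [M] pulls back to the trace of [N]
    factors through the image of [S], with trivial kernel. *)
Lemma embed_image_quotient (C : groupType) (M : normalClosed C)
    (r : {multiplicative subgroup S -> C}) :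
  (forall g, (r g \in M) = (val g \in N)) ->
  exists f : {multiplicative subgroup image_quotient -> quotient_group M},
    injective f.
Proof.
move=> rMN.
have lift (h : subgroup image_quotient) :
    exists g : subgroup S, coset N (val g) = val h.
  by have /image_quotientP[g Sg gh] := valP h; exists (Subgroup Sg).
pose l h := sval (cid (lift h)).
have lE h : coset N (val (l h)) = val h by rewrite /l; case: cid.
have rE g g' : coset M (r g) = coset M (r g') <->
               coset N (val g) = coset N (val g').
  have rV : (r g)^-1 = r g^-1.
    apply: (mulgI (r g)); rewrite mulgV -gmulfM mulgV.
    by apply: (mulgI (r 1)); rewrite -gmulfM !mulg1.
  by split=> /eq_cosetP H; apply/eq_cosetP; move: H; rewrite rV -gmulfM rMN.
pose f h := coset M (r (l h)).
have fM : {morph f : x y / x * y}.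
  move=> x y; rewrite /f -cosetM -gmulfM; apply/rE.
  by rewrite lE !valM cosetM !lE.
pose F := isMultiplicative.Build _ _ f fM.
pose f' : {multiplicative subgroup image_quotient -> quotient_group M} :=
  HB.pack f F.
exists f' => x y /rE; rewrite !lE; exact: val_inj.
Qed.

End ImageQuotient.

Arguments image_quotient {G} N S.

(** * Automorphisms inducing the identity on a quotient *)

Section InducingIdentity.
Variables (A : groupType) (K : normalClosed A).

Definition inducing1 : {pred aut A} :=
  fun f => `[< forall x, coset K (f x) = coset K x >].

Lemma inducing1P (f : aut A) :
  reflect (forall x, coset K (f x) = coset K x) (f \in inducing1).
Proof. exact: asboolP. Qed.

Fact inducing1M : mulg_closed inducing1.
Proof.
move=> f g /inducing1P f1 /inducing1P g1.
by apply/inducing1P => x; rewrite autME f1 g1.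
Qed.

Fact inducing1_1 : 1 \in inducing1.
Proof. exact/inducing1P. Qed.

Fact inducing1V : invg_closed inducing1.
Proof.
by move=> f /inducing1P f1; apply/inducing1P => x; rewrite -f1 -autME mulgV.
Qed.

HB.instance Definition _ := isMulClosed.Build (aut A) inducing1 inducing1M.
HB.instance Definition _ := isMul1Closed.Build (aut A) inducing1 inducing1_1.
HB.instance Definition _ := isInvClosed.Build (aut A) inducing1 inducing1V.

(** The invariant is the homomorphism [A -> A / K] obtained from [f^-1], recorded
    by its values on a finite generating set. The inverse is there because the
    cosets are left cosets. *)
Lemma finite_index_inducing1 :
  finitely_generated A -> finite_set [set: quotient_group K] ->
  finite_index (image_quotient (inn A) inducing1).
Proof.
move=> [s gen_s] finQ.
pose c (f : aut A) := map (fun x => coset K (f^-1 x)) s.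
apply: (@finite_index_image _ _ _ _ c); last exact: finite_range_map.
move=> f g /eq_in_map eq_fg.
pose E : {pred A} := fun x => `[< coset K (f^-1 x) = coset K (g^-1 x) >].
have EM : mulg_closed E.
  move=> x y /asboolP Ex /asboolP Ey; apply/asboolP.
  by rewrite !autM !cosetM Ex Ey.
have E1 : 1 \in E by apply/asboolP; rewrite !aut_fun1.
have EV : invg_closed E.
  by move=> x /asboolP Ex; apply/asboolP; rewrite !autV !cosetV Ex.
pose E' : groupClosed A := HB.pack E (isMulClosed.Build A E EM)
  (isMul1Closed.Build A E E1) (isInvClosed.Build A E EV).
have Eall x : coset K (f^-1 x) = coset K (g^-1 x).
  by apply/asboolP; apply: (gen_s E') => y sy; apply/asboolP/eq_fg.
by apply/inducing1P => x; rewrite autME Eall -autME mulVg.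
Qed.

(** Conjugation by [a] induces on [A / K] conjugation by the coset of [a], which
    is the identity only when that coset is central. *)
Lemma inner_inducing1 (f : aut A) (a : A) :
  centerless (quotient_group K) -> (forall x, f x = x ^ a) ->
  f \in inducing1 -> a \in K.
Proof.
move=> Zq fa /inducing1P f1; apply/coset_eq1/Zq => q.
rewrite -(coset_repr q); set x := repr q.
by rewrite /commute -[in LHS](f1 x) fa -!cosetM conjgE mulgA mulgV mul1g.
Qed.

Lemma inducing1_sub (L : groupClosed A) (f : aut A) :
  {subset K <= L} -> f \in inducing1 -> forall x, x \in L -> f x \in L.
Proof.
move=> KL /inducing1P f1 x Lx.
have /eq_cosetP/KL Lxf := esym (f1 x).
by rewrite -(mulVKg x (f x)) gpredM.
Qed.

End InducingIdentity.

(** Two automorphisms that agree on a set meeting the positive powers of every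
    element agree everywhere, since they agree up to roots. *)
Lemma eq_aut_on_roots (A : groupType) (L : {pred A}) (f g : A -> A) :
  {morph f : x y / x * y} -> {morph g : x y / x * y} ->
  unique_roots A -> (forall x, exists2 n, (0 < n)%N & x ^+ n \in L) ->
  {in L, f =1 g} -> f =1 g.
Proof.
have morphX (h : A -> A) : {morph h : x y / x * y} ->
    forall n x, h (x ^+ n) = h x ^+ n.
  move=> hM; elim=> [|n IHn] x; last by rewrite !expgS hM IHn.
  by apply: (mulgI (h 1)); rewrite -hM !mulg1.
move=> fM gM uroot pow fg x; have [n n_gt0 Lxn] := pow x.
by apply: (uroot n) => //; rewrite -(morphX f) // -(morphX g) // fg.
Qed.

(** * Restriction to a subgroup containing the kernel *)

Section Restriction.
Variables (A : groupType) (K : normalClosed A) (L : groupClosed A).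
Hypothesis KL : {subset K <= L}.

Definition restr_fun (g : subgroup (inducing1 K)) (x : subgroup L) :
    subgroup L :=
  Subgroup (inducing1_sub KL (valP g) (valP x)).

Fact restr_funM g : {morph restr_fun g : x y / x * y}.
Proof. by move=> x y; apply: val_inj; exact: (autM (val g)). Qed.

Fact restr_funK g : cancel (restr_fun g) (restr_fun g^-1).
Proof. by move=> x; apply: val_inj; exact: autK. Qed.

Fact restr_funVK g : cancel (restr_fun g^-1) (restr_fun g).
Proof. by move=> x; apply: val_inj; exact: autVK. Qed.

Definition restr g : aut (subgroup L) :=
  Aut (restr_funM g) (restr_funK g) (restr_funVK g).

Fact restrM : {morph restr : g h / g * h}.
Proof. by move=> g h; apply: autP => x; exact: val_inj. Qed.

HB.instance Definition _ :=
  isMultiplicative.Build (subgroup (inducing1 K)) (aut (subgroup L)) restr restrM.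

(** Each direction keeps the conjugating element: one from [L] still works on all
    of [A] by uniqueness of roots, and one from [A] has to lie in [K], hence in
    [L], because [A / K] is centerless. *)
Lemma restr_inn (g : subgroup (inducing1 K)) :
  unique_roots A -> finite_set [set: quotient_group K] ->
  centerless (quotient_group K) ->
  (restr g \in inn (subgroup L)) = (val g \in inn A).
Proof.
move=> uroot finQ Zq; apply/innP/innP => [[a ga]|[a ga]].
  exists (val a); apply: (@eq_aut_on_roots _ L) => //.
  - exact: autM.
  - by move=> x y; rewrite conjMg.
  - move=> x; have [n n_gt0 xn] := finite_group_torsion (coset K x) finQ.
    exists n => //; apply/KL/coset_eq1; rewrite -{}xn.
    by elim: n {n_gt0} => // n IHn; rewrite !expgS cosetM IHn.
  - by move=> x Lx; have := congr1 val (ga (Subgroup Lx)).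
have Ka : a \in K := inner_inducing1 Zq ga (valP g).
by exists (Subgroup (KL Ka)) => x; apply: val_inj; exact: ga.
Qed.

End Restriction.

Theorem theorem3p1 (A : groupType) (K : normalClosed A) (L : groupClosed A) :
  finitely_generated A ->
  unique_roots A ->
  finite_set [set: quotient_group K]%classic ->
  centerless (quotient_group K) ->
  {subset K <= L} ->
  exists H : groupClosed (out A),
    finite_index H /\
    exists f : {multiplicative subgroup H -> out (subgroup L)}, injective f.
Proof.
move=> fgA uroot finQ Zq KL.
pose H : groupClosed (quotient_group (inn A)) :=
  image_quotient (inn A) (inducing1 K).
exists H; split.
  exact: finite_index_inducing1.
apply: (@embed_image_quotient _ (inn A) _ _ (inn (subgroup L)) (restr KL)) => g.
exact: restr_inn.
Qed.
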